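(* Let $\mathbb{K}$ be a field, let $L$ be a lattice (a free abelian group of finite rank), and let $I\subset\mathbb{K}[L]$ be an ideal. Then $$\mathrm{Bin}(I)=\mathrm{Bin}\bigl(I\cap\mathbb{K}[T(I)^\perp\cap L]\bigr)\,\mathbb{K}[L],$$ where the right-hand side is the extension to $\mathbb{K}[L]$ of the binomial part of the ideal $I\cap\mathbb{K}[T(I)^\perp\cap L]$ of $\mathbb{K}[T(I)^\perp\cap L]$.
   Context: The group ring $\mathbb{K}[L]$ has $\mathbb{K}$-basis the Laurent monomials $\mathbf{x}^v$, $v\in L$. A binomial is an element with at most two terms, i.e. of the form $\mu\mathbf{x}^u-\lambda\mathbf{x}^v$ with $\lambda,\mu\in\mathbb{K}$. The binomial part $\mathrm{Bin}(J)$ of an ideal $J$ in a (Laurent) polynomial ring or lattice group ring over $\mathbb{K}$ is the $\mathbb{K}$-linear subspace of $J$ spanned by all binomials in $J$. Let $M=\mathrm{Hom}(L,\mathbb{Z})$ be the dual lattice. For $\omega\in\mathbb{Q}\otimes M$ and $f=\sum_v c_v\mathbf{x}^v$, the initial form $\mathrm{in}_\omega(f)$ is the sum of those terms $c_v\mathbf{x}^v$ of $f$ (with $c_v\ne0$) for which $\langle\omega,v\rangle$ is maximal; $\mathrm{in}_\omega(I)=\langle\mathrm{in}_\omega(f): f\in I\rangle$; and the tropical variety of $I$ is $T(I)=\{\omega\in\mathbb{Q}\otimes M : \mathrm{in}_\omega(I)\neq\mathbb{K}[L]\}$. Finally, $T(I)^\perp=\{v\in\mathbb{Q}\otimes L :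 \langle\omega,v\rangle=0\text{ for all }\omega\in T(I)\}$, and $\mathbb{K}[T(I)^\perp\cap L]\subseteq\mathbb{K}[L]$ is the group ring of the sublattice $T(I)^\perp\cap L$. *)

(* Defs.v *)
From HB Require Import structures.
From mathcomp Require Import all_boot all_order all_algebra.
From mathcomp Require Import finmap.
From mathcomp Require Import monalg.
From mathcomp Require Import boolp classical_sets.

Set Implicit Arguments.
Unset Strict Implicit.
Unset Printing Implicit Defensive.

Import Order.TTheory GRing.Theory Num.Theory VectorInternalTheory.

Local Open Scope classical_set_scope.
Local Open Scope ring_scope.

(* The group ring K[L]: finitely supported functions L -> K under convolution.
   The ring structure provided by monalg does not apply, since a monomType has
   no nontrivial units; only the underlying K-module {malg K[L]} is reused. *)
Definition grpring (K : comNzRingType) (L : zmodType) : Type := {malg K[L]}.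

Section GroupRing.
Variables (K : comNzRingType) (L : zmodType).

HB.instance Definition _ := GRing.Lmodule.on (grpring K L).

Implicit Types (f g h : grpring K L) (u v : L) (A B : {fset L}).

Definition xpow v : grpring K L := mkmalgU v 1.

Lemma mcoeff_xpow (c : K) v w : mcoeff w (c *: xpow v) = c *+ (v == w).
Proof. by rewrite mcoeffZ mcoeffU mulrnAr mulr1. Qed.

Lemma grpringEw A f :
  {subset msupp f <= A} -> f = \sum_(v <- A) mcoeff v f *: xpow v.
Proof.
move=> sA; rewrite {1}(@monalgEw _ _ f A); last by apply/fsubsetP.
apply: eq_bigr => v _; apply/malgP => w.
by rewrite mcoeffU mcoeff_xpow.
Qed.

Lemma grpringE f : f = \sum_(v <- msupp f) mcoeff v f *: xpow v.
Proof. exact: grpringEw. Qed.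

Definition grpring_mul f g : grpring K L :=
  \sum_(u <- msupp f) \sum_(v <- msupp g)
    (mcoeff u f * mcoeff v g) *: xpow (u + v).

Lemma grpring_mulEw A B f g :
    {subset msupp f <= A} -> {subset msupp g <= B} ->
  grpring_mul f g =
    \sum_(u <- A) \sum_(v <- B) (mcoeff u f * mcoeff v g) *: xpow (u + v).
Proof.
move=> /fsubsetP sA /fsubsetP sB; rewrite /grpring_mul.
rewrite (big_fset_incl _ sA) /=.
  apply: eq_bigr => u _; apply: (big_fset_incl _ sB) => v _ /mcoeff_outdom ->.
  by rewrite mulr0 scale0r.
move=> u _ /mcoeff_outdom ->.
by rewrite big1 // => v _; rewrite mul0r scale0r.
Qed.

Lemma grpring_mulC : commutative grpring_mul.
Proof.
move=> f g; rewrite /grpring_mul exchange_big /=.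
by apply: eq_bigr => u _; apply: eq_bigr => v _; rewrite mulrC addrC.
Qed.

Lemma grpring_mulDl : left_distributive grpring_mul +%R.
Proof.
move=> f g h; pose A := (msupp f `|` msupp g)%fset.
have sf : {subset msupp f <= A} by apply/fsubsetP; apply: fsubsetUl.
have sg : {subset msupp g <= A} by apply/fsubsetP; apply: fsubsetUr.
have sfg : {subset msupp (f + g) <= A} by apply/fsubsetP; apply: msuppD_le.
have sh : {subset msupp h <= msupp h} by [].
rewrite (grpring_mulEw sf sh) (grpring_mulEw sg sh) (grpring_mulEw sfg sh).
rewrite -big_split; apply: eq_bigr => u _ /=.
rewrite -big_split; apply: eq_bigr => v _ /=.
by rewrite mcoeffD mulrDl scalerDl.
Qed.

Lemma grpring_mulZl (c : K) f g :
  grpring_mul (c *: f) g = c *: grpring_mul f g.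
Proof.
have sf : {subset msupp (c *: f) <= msupp f} by apply/fsubsetP/msuppZ_le.
have sg : {subset msupp g <= msupp g} by [].
rewrite (grpring_mulEw sf sg) scaler_sumr; apply: eq_bigr => u _.
rewrite scaler_sumr; apply: eq_bigr => v _.
by rewrite scalerA mcoeffZ mulrA.
Qed.

Lemma grpring_mul_xpow u v : grpring_mul (xpow u) (xpow v) = xpow (u + v).
Proof.
have s w : {subset msupp (xpow w) <= [fset w]%fset}.
  by apply/fsubsetP; apply: msuppU_le.
by rewrite (grpring_mulEw (s u) (s v)) !big_seq_fset1 !mcoeffUU mulr1 scale1r.
Qed.

Lemma grpring_mul0l g : grpring_mul 0 g = 0.
Proof. by rewrite -[X in grpring_mul X](scale0r 0) grpring_mulZl scale0r. Qed.

Lemma grpring_ind (P : grpring K L -> Prop) :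
  P 0 -> (forall c v f, P f -> P (c *: xpow v + f)) -> forall f, P f.
Proof.
by move=> P0 PD f; rewrite (grpringE f); elim/big_rec: _ => // v g _; apply: PD.
Qed.

Lemma grpring_mul1l : left_id (xpow 0) grpring_mul.
Proof.
move=> f; rewrite grpring_mulC; elim/grpring_ind: f => [|c v f IHf].
  exact: grpring_mul0l.
by rewrite grpring_mulDl grpring_mulZl grpring_mul_xpow addr0 IHf.
Qed.

Lemma grpring_mulA : associative grpring_mul.
Proof.
move: grpring_mul grpring_mulC grpring_mulDl grpring_mulZl grpring_mul0l
  grpring_mul_xpow => m mC mDl mZl m0l mX.
have mDr f g h : m f (g + h) = m f g + m f h by rewrite mC mDl !(mC f).
have mZr c f g : m f (c *: g) = c *: m f g by rewrite mC mZl (mC f).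
have m0r f : m f 0 = 0 by rewrite mC m0l.
move=> f g h; elim/grpring_ind: f => [|c u f IHf]; first by rewrite !m0l.
rewrite mDl mZl IHf [m (_ + f) g]mDl mZl mDl mZl.
suff -> : m (xpow u) (m g h) = m (m (xpow u) g) h by []; clear f IHf.
elim/grpring_ind: g => [|d v g IHg]; first by rewrite !(m0l, m0r).
rewrite mDl mZl mDr mZr IHg mDr mZr mDl mZl.
suff -> : m (xpow u) (m (xpow v) h) = m (m (xpow u) (xpow v)) h by [].
clear g IHg.
elim/grpring_ind: h => [|e w h IHh]; first by rewrite !m0r.
by rewrite !mDr !mZr IHh !mX addrA.
Qed.

Lemma grpring_one_neq0 : xpow 0 != 0.
Proof. by rewrite monalgU_eq0 oner_eq0. Qed.

HB.instance Definition _ := GRing.Zmodule_isComNzRing.Build (grpring K L)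
  grpring_mulA grpring_mulC grpring_mul1l grpring_mulDl grpring_one_neq0.

Fact grpring_scaleAl (c : K) f g : c *: (f * g) = c *: f * g.
Proof. by rewrite [RHS]grpring_mulZl. Qed.

HB.instance Definition _ :=
  GRing.Lmodule_isLalgebra.Build K (grpring K L) grpring_scaleAl.

HB.instance Definition _ := GRing.Lalgebra_isComAlgebra.Build K (grpring K L).

Lemma xpow0 : xpow 0 = 1. Proof. by []. Qed.

Lemma xpowD u v : xpow (u + v) = xpow u * xpow v.
Proof. by rewrite [RHS]grpring_mul_xpow. Qed.

(* K[S], as a subset of K[L]. *)
Definition supported_on (S : set L) : set (grpring K L) :=
  [set f | forall v, v \in msupp f -> S v].

End GroupRing.

(* ring_quotient's idealr_closed is not used: it excludes the unit ideal. *)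
Definition is_ideal (A : comNzRingType) (I : set A) : Prop :=
  [/\ I 0, (forall f g, I f -> I g -> I (f + g))
    & (forall a f, I f -> I (a * f))].

Definition ideal_gen (A : comNzRingType) (X : set A) : set A :=
  smallest (@is_ideal A) X.

Definition is_subspace (K : nzRingType) (V : lmodType K) (W : set V) : Prop :=
  [/\ W 0, (forall f g, W f -> W g -> W (f + g))
    & (forall c f, W f -> W (c *: f))].

Definition lin_span (K : nzRingType) (V : lmodType K) (X : set V) : set V :=
  smallest (@is_subspace K V) X.

Definition is_binomial (K : comNzRingType) (L : zmodType) : set (grpring K L) :=
  [set f | exists (mu la : K) (u v : L),
     f = mu *: xpow K u - la *: xpow K v].

(* For an ideal J of a subring K[S] of K[L] the binomials of K[S] lying in J
   are the binomials of K[L] lying in J, so Bin J does not depend on S. *)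
Definition Bin (K : comNzRingType) (L : zmodType) (J : set (grpring K L)) :
    set (grpring K L) :=
  lin_span (J `&` @is_binomial K L).

(* A lattice is a vectType int: an int-module (that is, an abelian group)
   isomorphic to some 'rV[int]_n. *)

Definition dual_lattice (L : vectType int) : vectType int := 'Hom(L, int^o).

(* Q (x) V, in the coordinates of the Z-basis of V carried by its vectType
   structure. *)
Definition Qtensor (V : vectType int) : Type := 'rV[rat]_(dim V).
HB.instance Definition _ (V : vectType int) :=
  GRing.Lmodule.on (Qtensor V).

(* v |-> 1 (x) v *)
Definition Qinj (V : vectType int) (v : V) : Qtensor V :=
  map_mx intr (v2r v).

Definition Zbasis (V : vectType int) (i : 'I_(dim V)) : V :=
  r2v (delta_mx 0 i).

(* The Q-bilinear extension of the evaluation pairing of Hom(L, Z) with L,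
   see Qpair_inj. *)
Definition Qpair (L : vectType int) (w : Qtensor (dual_lattice L))
    (x : Qtensor L) : rat :=
  \sum_i \sum_j w 0 i * x 0 j *
    ((Zbasis i : 'Hom(L, int^o)) (Zbasis j) : int)%:~R.

Lemma Zbasis_sum (V : vectType int) (v : V) :
  v = \sum_i v2r v 0 i *: Zbasis i.
Proof.
rewrite -{1}(v2rK v) [X in r2v X]row_sum_delta raddf_sum.
by apply: eq_bigr => i _; apply: linearZ_LR.
Qed.

Lemma Qpair_inj (L : vectType int) (m : 'Hom(L, int^o)) (v : L) :
  Qpair (Qinj (m : dual_lattice L)) (Qinj v) = (m v : int)%:~R.
Proof.
pose c (i : 'I_(dim (dual_lattice L))) (j : 'I_(dim L)) : int :=
  (Zbasis i : 'Hom(L, int^o)) (Zbasis j).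
have mvE : m v =
    \sum_i \sum_j v2r (m : dual_lattice L) 0 i * v2r v 0 j * c i j.
  rewrite {1}(Zbasis_sum (m : dual_lattice L)) {1}(Zbasis_sum v).
  rewrite sum_lfunE; apply: eq_bigr => i _.
  rewrite raddf_sum; apply: eq_bigr => j _.
  set a := v2r _ 0 i; set b := v2r v 0 j.
  set f : 'Hom(L, int^o) := Zbasis i.
  transitivity (b *: (a *: f) (Zbasis j)); first exact: linearZ_LR.
  transitivity (b *: (a *: f (Zbasis j))).
    by congr (_ *: _); apply: scale_lfunE.
  by rewrite /GRing.scale /= mulrA [b * a]mulrC.
rewrite mvE rmorph_sum; apply: eq_bigr => i _.
rewrite rmorph_sum; apply: eq_bigr => j _.
by rewrite !rmorphM !mxE.
Qed.

(* in_w(f); the initial form of 0 is 0. *)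
Definition init_form (K : comNzRingType) (L : vectType int)
    (w : Qtensor (dual_lattice L)) (f : grpring K L) : grpring K L :=
  \sum_(v <- msupp f |
        all (fun v' => Qpair w (Qinj v') <= Qpair w (Qinj v)) (msupp f))
    mcoeff v f *: xpow K v.

Definition init_ideal (K : comNzRingType) (L : vectType int)
    (w : Qtensor (dual_lattice L)) (I : set (grpring K L)) :
    set (grpring K L) :=
  ideal_gen (init_form w @` I).

Definition tropical (K : comNzRingType) (L : vectType int)
    (I : set (grpring K L)) : set (Qtensor (dual_lattice L)) :=
  [set w | init_ideal w I <> setT].

Definition orthogonal_to (L : vectType int)
    (T : set (Qtensor (dual_lattice L))) : set (Qtensor L) :=
  [set x | forall w, T w -> Qpair w x = 0].

(* W `&` L, identifying v in L with 1 (x) v. *)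
Definition lattice_points (L : vectType int) (W : set (Qtensor L)) : set L :=
  @Qinj L @^-1` W.

(* Main.v *)
(* A unit of K[L] in I makes I, and then every initial ideal, the unit ideal.
   Otherwise a nonzero binomial b = mu x^u - la x^v of I has two distinct
   terms, and for w in T(I) the initial form of b cannot be a single term,
   since monomials are units of K[L]; hence <w, u> = <w, v>.  So u - v lies in
   the orthogonal of T(I), and b is the multiple by x^v of the binomial
   mu x^(u - v) - la of I. *)
Require Import Defs.
From mathcomp Require Import all_boot all_order all_algebra.
From mathcomp Require Import finmap monalg.
From mathcomp Require Import boolp classical_sets.
Import Order.TTheory GRing.Theory Num.Theory VectorInternalTheory.

Set Implicit Arguments.
Unset Strict Implicit.
Unset Printing Implicit Defensive.

Local Open Scope classical_set_scope.
Local Open Scope ring_scope.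

Section Ideals.
Variable A : comNzRingType.
Implicit Types X J : set A.

Lemma ideal_gen_ideal X : is_ideal (ideal_gen X).
Proof.
split=> [J [[J0 _ _] _] //|f g If Ig J JX|a f If J JX].
  by have [[_ JD _] _] := JX; apply: JD; [apply: If|apply: Ig].
by have [[_ _ JM] _] := JX; apply: JM; apply: If.
Qed.

Lemma sub_ideal_gen X : X `<=` ideal_gen X.
Proof. by move=> f Xf J [_]; apply. Qed.

Lemma ideal_gen_sub X J : is_ideal J -> X `<=` J -> ideal_gen X `<=` J.
Proof. by move=> iJ XJ f; apply. Qed.

Lemma ideal_unitT J (a f : A) : is_ideal J -> J f -> a * f = 1 -> J = setT.
Proof.
move=> [_ _ JM] Jf af1; rewrite -subTset => g _.
by rewrite -[g]mulr1 -af1 mulrA; apply: JM.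
Qed.

End Ideals.

Section LinearSpans.
Variables (K : nzRingType) (V : lmodType K).
Implicit Types X W : set V.

Lemma lin_span_subspace X : is_subspace (lin_span X).
Proof.
split=> [W [[W0 _ _] _] //|f g Xf Xg W WX|c f Xf W WX].
  by have [[_ WD _] _] := WX; apply: WD; [apply: Xf|apply: Xg].
by have [[_ _ WZ] _] := WX; apply: WZ; apply: Xf.
Qed.

Lemma sub_lin_span X : X `<=` lin_span X.
Proof. by move=> f Xf W [_]; apply. Qed.

Lemma lin_span_sub X W : is_subspace W -> X `<=` W -> lin_span X `<=` W.
Proof. by move=> sW XW f; apply. Qed.

End LinearSpans.

Section Binomials.
Variables (K : comNzRingType) (L : zmodType).
Implicit Types (I J : set (grpring K L)) (f : grpring K L) (u v : L).

Lemma ideal_subspace J : is_ideal J -> is_subspace J.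
Proof.
move=> [J0 JD JM]; split=> // c f Jf.
by rewrite -mulr_algl; apply: JM.
Qed.

Lemma mul_xpow_binomial v f :
  is_binomial f -> is_binomial (xpow K v * f).
Proof.
move=> [mu [la [s [t ->]]]]; exists mu, la, (v + s), (v + t).
by rewrite mulrBr -!scalerAr -!xpowD.
Qed.

Lemma sub_Bin I J : I `<=` J -> Bin I `<=` Bin J.
Proof.
move=> IJ; apply: lin_span_sub; first exact: lin_span_subspace.
by move=> f [If bf]; apply: sub_lin_span; split=> //; apply: IJ.
Qed.

(** A monomial times a binomial of [I] is again a binomial of [I], and every multiplier is a linear
    combination of monomials. *)
Lemma Bin_ideal I : is_ideal I -> is_ideal (Bin I).
Proof.
move=> [_ _ IM]; have [B0 BD BZ] := lin_span_subspace (I `&` @is_binomial K L).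
split=> // a f Bf; elim/grpring_ind: a => [|c v a IHa]; first by rewrite mul0r.
rewrite mulrDl -scalerAl; refine (BD _ _ (BZ _ _ _) IHa).
(* For fixed [v], the elements that multiplication by [xpow K v] sends into [Bin I] form a subspace,
   so it is enough to test the spanning binomials. *)
suff : Bin I `<=` [set g | Bin I (xpow K v * g)] by move=> /(_ f Bf).
apply: lin_span_sub => [|g [Ig bg]].
  split=> [|g h|d g]; rewrite /= ?mulr0 ?mulrDr -?scalerAr //.
  - exact: BD.
  - exact: BZ.
by apply: sub_lin_span; split; [apply: IM|apply: mul_xpow_binomial].
Qed.

Lemma xpowVK v : xpow K (- v) * xpow K v = 1.
Proof. by rewrite -xpowD addNr. Qed.

End Binomials.

Section MonomialsInIdeals.
Variables (K : fieldType) (L : zmodType).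

(** Exponents range over a group and [c] is invertible, so the monomial is a unit. *)
Lemma ideal_monomialT (J : set (grpring K L)) (c : K) (v : L) :
  is_ideal J -> c != 0 -> J (c *: xpow K v) -> J = setT.
Proof.
move=> iJ c0 Jv; apply: (@ideal_unitT _ _ (c^-1 *: xpow K (- v)) _ iJ Jv).
by rewrite -scalerAl -scalerAr scalerA mulVf // scale1r xpowVK.
Qed.

End MonomialsInIdeals.

Section InitialForms.
Variable L : vectType int.
Implicit Types w : Qtensor (dual_lattice L).

Lemma QinjB (u v : L) : Qinj (u - v) = Qinj u - Qinj v.
Proof. by rewrite /Qinj raddfB map_mxB. Qed.

Lemma QpairB w (x y : Qtensor L) : Qpair w (x - y) = Qpair w x - Qpair w y.
Proof.
rewrite /Qpair -sumrB; apply: eq_bigr => i _.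
by rewrite -sumrB; apply: eq_bigr => j _; rewrite !mxE mulrBr mulrBl.
Qed.

(** Only [u] passes the maximality test in [init_form]: any other exponent of the support fails it
    against [u]. *)
Lemma init_form_strict_max (K : comNzRingType) w (f : grpring K L) (u : L) :
  u \in msupp f ->
  (forall v, v \in msupp f -> v != u ->
     Qpair w (Qinj v) < Qpair w (Qinj u)) ->
  init_form w f = mcoeff u f *: xpow K u.
Proof.
move=> fu max_u; rewrite /init_form big_seq_cond.
rewrite (eq_bigl (fun v => (v \in (msupp f : seq L)) && (v == u))); last first.
  move=> v /=; case: (boolP (v \in _)) => //= fv.
  have [->|vu] := eqVneq v u.
    apply/allP => t ft; have [->|tu] := eqVneq t u; first exact: lexx.
    exact/ltW/max_u.
  by apply/negbTE/allPn; exists u => //; rewrite -ltNge; apply: max_u.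
by rewrite -big_seq_cond -big_filter filter_pred1_uniq ?big_seq1 // fset_uniq.
Qed.

Variable K : fieldType.
Implicit Types (I : set (grpring K L)) (mu la : K) (u v : L).

Lemma init_form_binomial w mu la u v :
  mu != 0 -> Qpair w (Qinj v) < Qpair w (Qinj u) ->
  init_form w (mu *: xpow K u - la *: xpow K v) = mu *: xpow K u.
Proof.
move=> mu0 uv; set b := _ - _.
(* Distinct exponents rule out cancellation, so the coefficient at [u] is exactly [mu]. *)
have vu : v != u by apply: contraTneq uv => ->; rewrite ltxx.
have coefb t : mcoeff t b = mu *+ (u == t) - la *+ (v == t).
  by rewrite mcoeffB !mcoeff_xpow.
have coefu : mcoeff u b = mu by rewrite coefb eqxx (negbTE vu) subr0.
rewrite -[in RHS]coefu; apply: init_form_strict_max.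
  by rewrite -mcoeff_neq0 coefu.
move=> t; rewrite -mcoeff_neq0 coefb => + tu.
rewrite [u == t]eq_sym (negbTE tu) sub0r.
by have [<-//|_] := eqVneq v t; rewrite oppr0 eqxx.
Qed.

(** Under the opposite strict inequality the initial form would be the monomial at [u], a unit,
    which excludes [w] from the tropical variety. *)
Lemma tropical_binomial_le I w mu la u v :
  tropical I w -> I (mu *: xpow K u - la *: xpow K v) -> mu != 0 ->
  Qpair w (Qinj u) <= Qpair w (Qinj v).
Proof.
move=> Tw Ib mu0; rewrite leNgt; apply/negP => uv; apply: Tw.
apply: (@ideal_monomialT _ _ _ mu u) => //; first exact: ideal_gen_ideal.
by apply: sub_ideal_gen; exists (mu *: xpow K u - la *: xpow K v);
  last exact: init_form_binomial.
Qed.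

(** The constant 1 is its own initial form for every [w]. *)
Lemma tropical_setT : tropical (@setT (grpring K L)) = set0.
Proof.
rewrite -subset0 => w; apply; apply: (@ideal_monomialT _ _ _ 1 0).
- exact: ideal_gen_ideal.
- exact: oner_neq0.
apply: sub_ideal_gen; exists (1 *: xpow K 0) => //.
have coef1 t : mcoeff t (1 *: xpow K (0 : L)) = (0 == t)%:R.
  exact: mcoeff_xpow.
rewrite -[in RHS](_ : mcoeff 0 (1 *: xpow K (0 : L)) = 1); last first.
  by rewrite coef1 eqxx.
apply: init_form_strict_max => [|t]; rewrite -mcoeff_neq0 coef1.
  by rewrite eqxx oner_neq0.
by have [<-|_] := eqVneq 0 t; rewrite ?mulr0n ?eqxx.
Qed.

Lemma tropical_binomial_orthogonal I mu la u v :
  is_ideal I -> mu != 0 -> la != 0 -> I (mu *: xpow K u - la *: xpow K v) ->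
  lattice_points (orthogonal_to (tropical I)) (u - v).
Proof.
move=> [_ _ IM] mu0 la0 Ib w Tw; rewrite QinjB QpairB; apply/eqP.
rewrite subr_eq0 eq_le (tropical_binomial_le _ Ib) //=.
(* The reverse inequality comes from the opposite binomial, in which the two terms trade places. *)
apply: (@tropical_binomial_le I w la mu) => //.
by rewrite -opprB -mulN1r; apply: IM.
Qed.

End InitialForms.

Theorem proposition12 (K : fieldType) (L : vectType int)
    (I : set (grpring K L)) (hI : is_ideal I) :
  Bin I =
  ideal_gen
    (Bin (I `&` supported_on (lattice_points (orthogonal_to (tropical I))))).
Proof.
set S := lattice_points _; apply/seteqP; split; last first.
  (* This inclusion holds because [Bin I] is already an ideal and [Bin] is monotone. *)
  exact: (ideal_gen_sub (Bin_ideal hI) (sub_Bin (@subIsetl _ _ _))).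
apply: lin_span_sub; first exact/ideal_subspace/ideal_gen_ideal.
have [_ _ IM] := hI.
have [_ _ GM] := ideal_gen_ideal (Bin (I `&` supported_on S)).
have [IT b [Ib bb]|InT b [Ib [mu [la [u [v bE]]]]]] := pselect (I = setT).
  refine (sub_ideal_gen (sub_lin_span _)); split=> //; split=> // t _.
  (* With an empty tropical variety orthogonality is vacuous, so [S] is all of [L]. *)
  by rewrite /S IT tropical_setT => w [].
(* Dividing by the second monomial moves the exponents [u] and [v] to [u - v] and 0; multiplying
   back recovers [b]. *)
suff Ib' : (I `&` supported_on S) (xpow K (- v) * b).
  rewrite -[b]mul1r -(xpowVK K (- v)) -mulrA opprK; apply: GM.
  refine (sub_ideal_gen (sub_lin_span _)); split=> //.
  by apply: mul_xpow_binomial; exists mu, la, u, v.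
split; first exact: IM.
have S0 : S 0.
  by move=> w _; rewrite -(subrr 0) QinjB QpairB subrr.
have Suv : mu != 0 -> S (u - v).
  (* If [la] vanishes, [b] is a nonzero monomial and [I] would be the unit ideal. *)
  move=> mu0; have [la0|la0] := eqVneq la 0.
    case: InT; apply: (@ideal_monomialT _ _ _ mu u) => //.
    by move: Ib; rewrite bE la0 scale0r subr0.
  by apply: (tropical_binomial_orthogonal hI mu0 la0); rewrite -bE.
move=> t; rewrite bE mulrBr -!scalerAr -!xpowD addNr [- v + u]addrC.
rewrite -mcoeff_neq0 mcoeffD mcoeffN !mcoeff_xpow.
(* The exponent 0 is covered by [S0]; away from 0, a nonzero coefficient forces [t] to be [u - v]
   and [mu] to be nonzero, as [Suv] requires. *)
have [<-//|_] := eqVneq 0 t; rewrite subr0.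
by have [<-|_] := eqVneq (u - v) t; rewrite ?eqxx.
Qed.
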